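(* Let $f=\frac1n\sum_{i=1}^n f_i$ satisfy: (1) each $\nabla f_i$ is $L$-Lipschitz on $\mathbb{R}^d$; (2) $f^*=\inf_{x\in\mathbb{R}^d} f(x)>-\infty$; (3) there is $\sigma>0$ with $\frac1n\sum_{i=1}^n\|\nabla f_i(x)-\nabla f(x)\|^2\le\sigma^2$ for all $x\in\mathbb{R}^d$. Let $\epsilon>0$ and let $c_\beta,c_\epsilon\ge\alpha$ for a certain constant $\alpha>0$. Let $\psi=\frac{2\eta^2L^2m}{B}+\frac2\alpha+2$ and choose $\beta_1>0$, $\alpha$ and $\eta>0$ such that $\beta_1\le S\epsilon$ and $\phi=\frac12-\frac1{2\alpha}-\frac{L\eta}{2}-\frac{\eta^2L^2m}{2B}>0$, where $S$ is the number of epochs. Then the output $x_\zeta$ of AbaSPIDER (run with inputs $x_0,m,B,\eta,c_\beta,c_\epsilon,\beta_1$ and $S$ epochs) satisfies $$\mathbb{E}\|\nabla f(x_\zeta)\|^2\le\frac{\psi\,(f(x_0)-f^* )}{\phi\,\eta K}+\frac{\psi\epsilon}{2\phi\alpha}+\frac{4\epsilon}{\alpha},$$ where $K=Sm$.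
   Context: For a finite index set (or list) $\mathcal{S}$, $\nabla f_{\mathcal{S}}(\cdot)=\frac1{|\mathcal{S}|}\sum_{i\in\mathcal{S}}\nabla f_i(\cdot)$. AbaSPIDER. Inputs: $x_0\in\mathbb{R}^d$, positive integers $m$ (epoch length), $B$ (mini-batch size), $S$ (number of epochs), and reals $\eta,c_\beta,c_\epsilon,\beta_1>0$; $\epsilon>0$ is the target accuracy. Set $\tilde x^0=x_0$. For $s=1,\dots,S$: set $x_0^s=\tilde x^{s-1}$; sample $\mathcal{N}_s$ uniformly from $[n]=\{1,\dots,n\}$ without replacement, of size $N_s=\min\{c_\beta\sigma^2\beta_s^{-1},\,c_\epsilon\sigma^2\epsilon^{-1},\,n\}$ (rounded up to an integer; $\beta_s^{-1}=+\infty$ if $\beta_s=0$); set $v_0^s=\nabla f_{\mathcal{N}_s}(\tilde x^{s-1})$ and $x_1^s=x_0^s-\eta v_0^s$; for $t=1,\dots,m-1$, draw a fresh independent mini-batch $\mathcal{B}$ of size $B$ uniformly from $[n]$ with replacement and set $v_t^s=\nabla f_{\mathcal{B}}(x_t^s)-\nabla f_{\mathcal{B}}(x_{t-1}^s)+v_{t-1}^s$, $x_{t+1}^s=x_t^s-\eta v_t^s$; finally set $\beta_{s+1}=\frac1m\sum_{t=0}^{m-1}\|v_t^s\|^2$ and $\tilde x^s=x_m^s$. The output $x_\zeta$ is chosen uniformly at random from $\{x_{t-1}^s\}_{s\in[S],\,t\in[m]}$. *)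

(* Defs.v *)
(* MathComp / MathComp-Analysis *)
From HB Require Import structures.
From mathcomp Require Import all_boot all_order all_algebra.
From mathcomp Require Import all_classical all_reals all_analysis.
Import Order.TTheory GRing.Theory Num.Theory.
Import numFieldNormedType.Exports.

Set Implicit Arguments.
Unset Strict Implicit.
Unset Printing Implicit Defensive.

Local Open Scope classical_set_scope.
Local Open Scope ring_scope.

(* The library norm on 'rV[R]_d is the sup norm, hence this Euclidean one. *)
Definition enorm (R : realType) (d : nat) (x : 'rV[R]_d) : R :=
  Num.sqrt (\sum_j x 0 j ^+ 2).

Definition grad (R : realType) (d : nat) (g : 'rV[R]_d -> R) (x : 'rV[R]_d) :
    'rV[R]_d :=
  \row_j 'D_(delta_mx 0 j) g x.

Definition favg (R : realType) (d n : nat) (f : 'I_n -> 'rV[R]_d -> R)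
    (x : 'rV[R]_d) : R :=
  n%:R^-1 * \sum_i f i x.

Definition batch_grad (R : realType) (d n : nat) (f : 'I_n -> 'rV[R]_d -> R)
    (s : seq 'I_n) (x : 'rV[R]_d) : 'rV[R]_d :=
  (size s)%:R^-1 *: \sum_(i <- s) grad (f i) x.

(* One realization of all the mini-batches.  Epochs are numbered from 1:
   [large w s] is the large batch opening epoch s, and [mini w s t] is the
   batch used to form v_t^s, for 1 <= t <= m - 1; the values at other indices
   are irrelevant. *)
Record draws (n B : nat) := Draws {
  large : nat -> {set 'I_n};
  mini : nat -> nat -> B.-tuple 'I_n
}.

Section AbaSPIDER.
Context (R : realType) (d n B : nat) (f : 'I_n -> 'rV[R]_d -> R).
Context (x0 : 'rV[R]_d) (m S : nat) (eta sigma eps cbeta ceps beta1 : R).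

(* The pair (x_t, v_t) inside an epoch started at y. *)
Fixpoint inner (y : 'rV[R]_d) (N : {set 'I_n}) (b : nat -> B.-tuple 'I_n)
    (t : nat) : 'rV[R]_d * 'rV[R]_d :=
  if t is t'.+1 then
    let: (x, v) := inner y N b t' in
    let x' := x - eta *: v in
    (x', batch_grad f (b t) x' - batch_grad f (b t) x + v)
  else (y, batch_grad f (enum N) y).

(* The pair (x~^s, beta_{s+1}) available after s epochs. *)
Fixpoint outer (w : draws n B) (s : nat) : 'rV[R]_d * R :=
  if s is s'.+1 then
    let xv := inner (outer w s').1 (large w s) (mini w s) in
    ((xv m).1, m%:R^-1 * \sum_(t < m) enorm (xv t).2 ^+ 2)
  else (x0, beta1).

(* x_t^s, for s >= 1 *)
Definition iterate (w : draws n B) (s t : nat) : 'rV[R]_d :=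
  (inner (outer w s.-1).1 (large w s) (mini w s) t).1.

(* The term in beta^-1 is +oo, hence absent, when beta = 0. *)
Definition large_size (beta : R) : nat :=
  let cap := Num.min (ceps * sigma ^+ 2 / eps) n%:R in
  absz (Num.ceil (if beta == 0 then cap
                  else Num.min (cbeta * sigma ^+ 2 / beta) cap)).

(* The prescribed size of [large w s], with beta_s read off the draws of the
   first s - 1 epochs in w. *)
Definition Nsize (w : draws n B) (s : nat) : nat :=
  large_size (outer w s.-1).2.

(* Draws are made in the lexicographic order of (s, t), where (s, 0) is the
   draw of the large batch of epoch s and (s, t), 1 <= t <= m - 1, that of its
   t-th mini-batch. *)
Definition precedes (s' t' s t : nat) : bool :=
  (s' < s)%N || ((s' == s) && (t' < t)%N).

Definition same_past (s t : nat) (w a : draws n B) : Prop :=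
  (forall s', (0 < s')%N -> precedes s' 0 s t -> large w s' = large a s') /\
  (forall s' t', (0 < s')%N -> (0 < t' < m)%N -> precedes s' t' s t ->
     mini w s' t' = mini a s' t').

Context (dT : measure_display) (T : measurableType dT) (P : probability T R).

(* The random variables (xi, zeta) follow the sampling scheme: each draw has
   the prescribed law conditionally on any past [a] of the execution, written
   as P(past /\ draw = b) = P(past) * (probability of b given the past).  The
   event of having past [a] is an atom of the (finite) history, of which the
   size of the next large batch is a function.  Position (S.+1, 0) is the end
   of the run. *)
Record AbaSPIDER_sampling (xi : T -> draws n B) (zeta : T -> 'I_S * 'I_m) :
    Prop := {
  measurable_large : forall (s : nat) (A : {set 'I_n}), (0 < s <= S)%N ->
    measurable [set w | large (xi w) s = A];
  measurable_mini : forall (s t : nat) (b : B.-tuple 'I_n),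
    (0 < s <= S)%N -> (0 < t < m)%N ->
    measurable [set w | mini (xi w) s t = b];
  measurable_zeta : forall st : 'I_S * 'I_m, measurable [set w | zeta w = st];
  (* Sampling without replacement: a uniform subset of the prescribed size. *)
  law_large : forall (s : nat) (a : draws n B) (A : {set 'I_n}),
    (0 < s <= S)%N ->
    P [set w | same_past s 0 (xi w) a /\ large (xi w) s = A] =
    (P [set w | same_past s 0 (xi w) a] *
     (if #|A| == Nsize a s then 'C(n, Nsize a s)%:R^-1 else 0)%R%:E)%E;
  (* Sampling with replacement: a uniform B-tuple. *)
  law_mini : forall (s t : nat) (a : draws n B) (b : B.-tuple 'I_n),
    (0 < s <= S)%N -> (0 < t < m)%N ->
    P [set w | same_past s t (xi w) a /\ mini (xi w) s t = b] =
    (P [set w | same_past s t (xi w) a] * ((n ^ B)%N%:R^-1)%R%:E)%E;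
  law_zeta : forall (a : draws n B) (st : 'I_S * 'I_m),
    P [set w | same_past S.+1 0 (xi w) a /\ zeta w = st] =
    (P [set w | same_past S.+1 0 (xi w) a] * ((S * m)%N%:R^-1)%R%:E)%E
}.

(* zeta = (s-1, t-1) selects x_{t-1}^s, for 1 <= s <= S and 1 <= t <= m. *)
Definition output (w : draws n B) (z : 'I_S * 'I_m) : 'rV[R]_d :=
  iterate w z.1.+1 z.2.

End AbaSPIDER.

(* Main.v *)
Require Import Defs.
From HB Require Import structures.
From mathcomp Require Import all_boot all_order all_algebra.
From mathcomp Require Import all_classical all_reals all_analysis.
From mathcomp Require Import fingroup perm.
From mathcomp Require Import measurable_realfun.
From mathcomp Require Import ring lra.
Import Order.TTheory GRing.Theory Num.Theory.
Import numFieldNormedType.Exports.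
Local Open Scope classical_set_scope.
Local Open Scope ring_scope.

(** Write [x_t], [v_t] for the iterates and gradient estimators of an epoch and
    [e_t = v_t - grad f x_t].  Sums below run over all epochs [s] and all [t < m],
    [K = S m] is their number of terms, and [V], [E], [G] are the sums of the
    expectations of [|v_t|^2], [|e_t|^2] and [|grad f x_t|^2].

    Three facts are combined.

    - Along every run, smoothness of [f] gives
      [f x_{t+1} <= f x_t - (eta/2) |grad f x_t|^2 - (eta/2) (1 - L eta) |v_t|^2
      + (eta/2) |e_t|^2] ([inexact_gradient_step]); it telescopes over the whole
      run ([run_descent]).
    - Given the past, the increment [e_{t+1} - e_t] is an average of [B] independent
      centred terms, so that the expectation of [|e_t|^2] grows by at most
      [(L^2 eta^2 / B) |v_t|^2] per step ([minibatch_error_le]).  It starts from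
      the variance of the large batch, whose size makes it at most
      [(beta_s + eps) / alpha] ([large_batch_error_le], [large_size_variance_le]).
      As [beta_{s+1}] is the average of [|v_t|^2] over epoch [s] and
      [beta_1 <= S eps], summing over the run yields
      [E <= (2 K eps + V) / alpha + (L^2 eta^2 m / B) V] ([total_err]).
    - [|grad f x_t|^2 <= 2 |e_t|^2 + 2 |v_t|^2].

    They imply [phi V + G / 2 <= (f x_0 - fstar) / eta + K eps / alpha] and
    [G <= psi V + 4 K eps / alpha].  Dropping [G / 2] would leave
    [psi eps / (phi alpha)], twice the term that the theorem allows; keeping it
    recovers the factor 2 ([final_arithmetic]).

    On the probabilistic side, only finitely many draws enter a run.  The random
    draws are therefore encoded in a finite type, where the law of each draw given
    the past is an identity between finite sums, and conditioning on the past is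
    [sampling_tower].  Finally [expectation_output] turns the expectation of the
    theorem into [G / K]. *)

Set Implicit Arguments.
Unset Strict Implicit.
Unset Printing Implicit Defensive.

(** * Euclidean geometry and descent *)

Section Euclidean.
Context (R : realType) (d : nat).
Implicit Types u v x y : 'rV[R]_d.

Definition dot u v : R := \sum_j u 0 j * v 0 j.

Lemma enorm_sq u : enorm u ^+ 2 = \sum_j u 0 j ^+ 2.
Proof. by rewrite sqr_sqrtr // sumr_ge0 // => j _; exact: sqr_ge0. Qed.

Lemma enorm_ge0 u : 0 <= enorm u.
Proof. exact: sqrtr_ge0. Qed.

Lemma enorm_sqZ a u : enorm (a *: u) ^+ 2 = a ^+ 2 * enorm u ^+ 2.
Proof.
rewrite !enorm_sq mulr_sumr; apply: eq_bigr => j _.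
by rewrite mxE exprMn.
Qed.

Lemma enorm_sqB u v :
  enorm (u - v) ^+ 2 = enorm u ^+ 2 - 2 * dot u v + enorm v ^+ 2.
Proof.
rewrite !enorm_sq /dot mulr_sumr -sumrB -big_split /=.
by apply: eq_bigr => j _; rewrite !mxE; ring.
Qed.

Lemma dotZr a u v : dot u (a *: v) = a * dot u v.
Proof.
by rewrite /dot mulr_sumr; apply: eq_bigr => j _; rewrite mxE; ring.
Qed.

Lemma dotBl u v x : dot (u - v) x = dot u x - dot v x.
Proof.
by rewrite /dot -sumrB; apply: eq_bigr => j _; rewrite !mxE; ring.
Qed.

Lemma enorm_sqB_le u v :
  enorm (u - v) ^+ 2 <= 2 * enorm u ^+ 2 + 2 * enorm v ^+ 2.
Proof.
rewrite !enorm_sq !mulr_sumr -big_split ler_sum //= => j _.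
by rewrite !mxE; have := sqr_ge0 (u 0 j + v 0 j); nra.
Qed.

Lemma cauchy_schwarz u v : dot u v <= enorm u * enorm v.
Proof.
apply: le_trans (ler_norm _) _; rewrite -ler_sqr ?nnegrE ?mulr_ge0 ?enorm_ge0 //.
rewrite real_normK ?num_real // exprMn !enorm_sq.
(* Lagrange's identity: the defect is a sum of squares. *)
have : 0 <= \sum_i \sum_j (u 0 i * v 0 j - u 0 j * v 0 i) ^+ 2.
  by apply: sumr_ge0 => i _; apply: sumr_ge0 => j _; exact: sqr_ge0.
have -> : \sum_i \sum_j (u 0 i * v 0 j - u 0 j * v 0 i) ^+ 2 =
    2 * ((\sum_i u 0 i ^+ 2) * (\sum_j v 0 j ^+ 2) - dot u v ^+ 2).
  transitivity (\sum_i \sum_j (u 0 i ^+ 2 * v 0 j ^+ 2 + v 0 i ^+ 2 * u 0 j ^+ 2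
      - 2 * ((u 0 i * v 0 i) * (u 0 j * v 0 j)))).
    by apply: eq_bigr => i _; apply: eq_bigr => j _; ring.
  under eq_bigr do rewrite sumrB big_split /= -!mulr_sumr.
  rewrite sumrB big_split /= -!mulr_suml -!mulr_sumr -mulr_suml -/(dot u v).
  by ring.
by rewrite pmulr_rge0 // subr_ge0.
Qed.

End Euclidean.

Section Descent.
Context (R : realType) (d : nat).
Implicit Types (g : 'rV[R]_d -> R) (x y h : 'rV[R]_d).

Lemma derive_dot g x h : differentiable g x -> 'D_h g x = dot (grad g x) h.
Proof.
move=> dg; rewrite deriveE // {1}(row_sum_delta h) linear_sum /=.
apply: eq_bigr => j _; rewrite linearZ /= mxE deriveE //.
by rewrite mulrC.
Qed.

Lemma is_derive_line g x h (t : R) : differentiable g (x + t *: h) ->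
  is_derive t 1 (fun s : R => g (x + s *: h)) (dot (grad g (x + t *: h)) h).
Proof.
move=> dg.
(* Both derivatives are limits of the same difference quotient. *)
have quot : (fun k : R => k^-1 *: (((fun s => g (x + s *: h)) \o shift t) (k *: 1)
      - g (x + t *: h))) =
    (fun k : R => k^-1 *: ((g \o shift (x + t *: h)) (k *: h) - g (x + t *: h))).
  apply/funext => k; congr (_ *: (g _ - _)) => /=.
  by rewrite [k *: 1]mulr1 scalerDl addrCA.
have dq : derivable g (x + t *: h) h by exact: diff_derivable.
apply: DeriveDef; first by rewrite /derivable quot.
by rewrite /derive quot; exact: derive_dot.
Qed.

(** The function [s |-> g (x + s h) - s <grad g x, h> - (L |h|^2 / 2) s^2] has a
    nonpositive derivative on [0, 1], by the Lipschitz bound and Cauchy-Schwarz;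
    the mean value theorem compares its values at 0 and 1. *)
Lemma lipschitz_grad_descent g (L : R) : (forall x, differentiable g x) ->
  (forall x y, enorm (grad g x - grad g y) <= L * enorm (x - y)) ->
  forall x h, g (x + h) <= g x + dot (grad g x) h + L / 2 * enorm h ^+ 2.
Proof.
move=> dg lg x h.
set c := dot (grad g x) h; set q := L / 2 * enorm h ^+ 2.
pose k (s : R) := g (x + s *: h) - s * c - s ^+ 2 * q.
have dk (s : R) : is_derive s 1 k
    (dot (grad g (x + s *: h)) h - c - 2 * s * q).
  have := is_derive_line (dg (x + s *: h)) => ?.
  rewrite /k; apply: is_derive_eq.
  have scaleE (a b : R) : a *: b = a * b by [].
  by rewrite !scaleE; ring.
have k_cont : {within `[0, 1], continuous k}.
  apply: derivable_within_continuous => s _.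
  exact: (@ex_derive _ _ _ _ _ _ _ (dk s)).
have [s /andP[s_gt0 _] ks] := MVT ltr01 (fun s _ => dk s) k_cont.
have k0 : k 0 = g x by rewrite /k scale0r addr0 !mul0r expr0n mul0r !subr0.
have k1 : k 1 = g (x + h) - c - q by rewrite /k scale1r expr1n !mul1r.
suff : k 1 <= k 0 by rewrite k0 k1; lra.
rewrite -subr_le0 ks subr0 mulr1 -dotBl.
rewrite bnd_simp in s_gt0.
have lip : enorm (grad g (x + s *: h) - grad g x) <= L * (s * enorm h).
  apply: le_trans (lg _ _) _; rewrite addrC addKr.
  rewrite (_ : enorm (s *: h) = s * enorm h) //; apply/eqP.
  rewrite -(@eqrXn2 _ 2) ?mulr_ge0 ?enorm_ge0 ?(ltW s_gt0) //.
  by rewrite enorm_sqZ exprMn.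
have := le_trans (cauchy_schwarz _ _) (ler_wpM2r (enorm_ge0 h) lip).
rewrite /q; lra.
Qed.

(** The inner product of [grad g x] with [v] in the smoothness bound is
    half of [|grad g x|^2 + |v|^2 - |v - grad g x|^2]. *)
Lemma inexact_gradient_step g (L eta : R) x v :
  (forall x h, g (x + h) <= g x + dot (grad g x) h + L / 2 * enorm h ^+ 2) ->
  eta / 2 * enorm (grad g x) ^+ 2 + eta / 2 * (1 - L * eta) * enorm v ^+ 2
    - eta / 2 * enorm (v - grad g x) ^+ 2 <= g x - g (x - eta *: v).
Proof.
move=> desc; have := desc x (- eta *: v).
rewrite dotZr enorm_sqZ scaleNr enorm_sqB.
have -> : dot v (grad g x) = dot (grad g x) v.
  by apply: eq_bigr => j _; rewrite mulrC.
nra.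
Qed.

End Descent.

Section FiniteSum.
Context (R : realType) (d n : nat) (f : 'I_n -> 'rV[R]_d -> R).
Hypothesis df : forall i x, differentiable (f i) x.

Lemma grad_favg x : grad (favg f) x = n%:R^-1 *: \sum_i grad (f i) x.
Proof.
apply/rowP => j; rewrite !mxE summxE.
have der i : derivable (f i) x (delta_mx 0 j) by exact: diff_derivable.
have -> : favg f = n%:R^-1 *: (\sum_i f i).
  by apply/funext => y; rewrite /favg /= fct_sumE.
rewrite deriveZ; last exact: derivable_sum.
rewrite derive_sum //; congr (_ *: _).
by apply: eq_bigr => i _; rewrite mxE.
Qed.

(** The smoothness bound is linear in the function, so it passes from the [f i] to
    their average. *)
Lemma favg_descent (L : R) : (0 < n)%N ->
  (forall i x y, enorm (grad (f i) x - grad (f i) y) <= L * enorm (x - y)) ->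
  forall x h, favg f (x + h) <=
    favg f x + dot (grad (favg f) x) h + L / 2 * enorm h ^+ 2.
Proof.
move=> n_gt0 lf x h; rewrite grad_favg.
have n0 : n%:R != 0 :> R by rewrite pnatr_eq0 -lt0n.
have -> : dot (n%:R^-1 *: \sum_i grad (f i) x) h =
    n%:R^-1 * \sum_i dot (grad (f i) x) h.
  rewrite exchange_big /dot mulr_sumr; apply: eq_bigr => j _.
  by rewrite mxE summxE -mulrA mulr_suml.
have -> : L / 2 * enorm h ^+ 2 = n%:R^-1 * \sum_(i < n) (L / 2 * enorm h ^+ 2).
  by rewrite sumr_const card_ord -[X in _ = _ * X]mulr_natl mulKf.
rewrite /favg -!mulrDr -!big_split ler_wpM2l ?invr_ge0 //=.
apply: ler_sum => i _; exact: lipschitz_grad_descent.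
Qed.

End FiniteSum.

(** * Second moments of sampled sums *)

Section ScalarSampling.
Context (R : realType) (n : nat) (y : 'I_n -> R).
Hypothesis n_gt0 : (0 < n)%N.
Hypothesis y_centered : \sum_i y i = 0.

Let n0 : n%:R != 0 :> R. Proof. by rewrite pnatr_eq0 -lt0n. Qed.

Lemma sum_tupleS (k : nat) (F : k.+1.-tuple 'I_n -> R) :
  \sum_b F b = \sum_i \sum_(b : k.-tuple 'I_n) F (cons_tuple i b).
Proof.
rewrite pair_bigA /= (reindex (fun p : 'I_n * k.-tuple 'I_n =>
  cons_tuple p.1 p.2)) //=.
exists (fun b : k.+1.-tuple 'I_n => (thead b, [tuple of behead b])) => [[i b]|b] _ /=.
  by congr pair; apply: val_inj.
by apply: val_inj => /=; rewrite [in RHS](tuple_eta b).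
Qed.

(** The offset [c] makes the induction on the length go through: the first
    entry of the tuple is absorbed into it. *)
Lemma tuple_sum_second_moment (k : nat) (c : R) :
  \sum_(b : k.-tuple 'I_n) (c + \sum_(i <- b) y i) ^+ 2 =
  n%:R ^+ k * (c ^+ 2 + k%:R / n%:R * \sum_i y i ^+ 2).
Proof.
set q := \sum_i y i ^+ 2; elim: k c => [|k IHk] c.
  rewrite (big_pred1 [tuple]) => [|b]; last by apply/esym/eqP; exact: tuple0.
  by rewrite big_nil expr0 mul0r !mul0r !addr0 mul1r.
rewrite sum_tupleS.
under eq_bigr => i _ do under eq_bigr => b _ do rewrite big_cons addrA.
under eq_bigr => i _ do rewrite IHk sqrrD.
rewrite -mulr_sumr !big_split /= -/q -!mulr_sumr.
rewrite !sumr_const card_ord.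
rewrite y_centered mulr0.
rewrite -(mulr_natl c n) -(mulr_natl q n) exprS -[k.+1%:R]natr1.
move: (n%:R ^+ k : R) (k%:R : R) (n%:R : R) n0 => e k' n' n'0.
by field.
Qed.

Lemma card_draws_pair_perm (s : {perm 'I_n}) (N : nat) (i j : 'I_n) :
  #|[pred A : {set 'I_n} | [&& #|A| == N, s i \in A & s j \in A]]| =
  #|[pred A : {set 'I_n} | [&& #|A| == N, i \in A & j \in A]]|.
Proof.
have imsK (A : {set 'I_n}) : s @: (invg s @: A) = A.
  rewrite -imset_comp (eq_imset (g := id)) ?imset_id // => x /=.
  by rewrite permKV.
have s_inj := @perm_inj _ s.
rewrite -[RHS](card_imset _ (imset_inj s_inj)); apply: eq_card => A.
rewrite -[A]imsK; move: (invg s @: A) => C {A}.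
rewrite [RHS]mem_imset; last exact: imset_inj.
by rewrite !inE card_imset // !mem_imset.
Qed.

(** Distinct elements of a sample drawn without replacement are negatively
    correlated: by symmetry every [j != i] accompanies [i] in equally many
    [N]-subsets, so that, as the [y j] add up to 0, the cross terms of [i] add
    up to a nonpositive multiple of [y i ^+ 2]. *)
Lemma subset_sum_second_moment (N : nat) :
  \sum_(A : {set 'I_n} | #|A| == N) (\sum_(i in A) y i) ^+ 2 <=
  N%:R / n%:R * 'C(n, N)%:R * \sum_i y i ^+ 2.
Proof.
pose c i j : R := #|[pred A : {set 'I_n} | [&& #|A| == N, i \in A & j \in A]]|%:R.
have cE i j : c i j = \sum_(A : {set 'I_n} | #|A| == N)
    ((i \in A)%:R * (j \in A)%:R).
  rewrite /c -sum1_card natr_sum big_mkcond [RHS]big_mkcond /=.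
  apply: eq_bigr => A _; rewrite inE -natrM mulnb.
  by case: eqP => //= _; case: andP.
have -> : \sum_(A : {set 'I_n} | #|A| == N) (\sum_(i in A) y i) ^+ 2 =
    \sum_i \sum_j c i j * (y i * y j).
  transitivity (\sum_(A : {set 'I_n} | #|A| == N) \sum_i \sum_j
      ((i \in A)%:R * (j \in A)%:R) * (y i * y j)).
    apply: eq_bigr => A _.
    have -> : \sum_(i in A) y i = \sum_i (i \in A)%:R * y i.
      by rewrite big_mkcond; apply: eq_bigr => i _; case: ifP; rewrite ?mul1r ?mul0r.
    rewrite expr2 mulr_suml; apply: eq_bigr => i _.
    by rewrite mulr_sumr; apply: eq_bigr => j _; ring.
  rewrite exchange_big; apply: eq_bigr => i _ /=.
  rewrite exchange_big; apply: eq_bigr => j _ /=.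
  by rewrite cE mulr_suml.
have diag i j : c i i = c j j.
  by rewrite /c -(card_draws_pair_perm (tperm i j) N i i) tpermL.
(* Count the pairs of an [N]-subset and one of its elements in two ways. *)
have diagE i : c i i = N%:R / n%:R * 'C(n, N)%:R.
  apply: (mulfI n0); transitivity (\sum_(j < n) c j j).
    by rewrite (eq_bigr (fun=> c i i)) // sumr_const card_ord mulr_natl.
  transitivity (\sum_(A : {set 'I_n} | #|A| == N) (N%:R : R)).
    under eq_bigr do rewrite cE.
    rewrite exchange_big; apply: eq_bigr => A /eqP <- /=.
    rewrite -sum1_card natr_sum [RHS]big_mkcond; apply: eq_bigr => i' _ /=.
    by case: (i' \in A); rewrite ?mulr1 ?mulr0.
  rewrite sumr_const -(mulr_natr N%:R).
  have -> : #|[pred A : {set 'I_n} | #|A| == N]| = 'C(n, N).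
    rewrite -[in RHS](card_ord n) -card_draws; apply: eq_card => A; by rewrite !inE.
  by rewrite mulrA [n%:R * _]mulrC divfK.
rewrite mulr_sumr; apply: ler_sum => i _; rewrite -(diagE i).
have [C C_ge0 cC] : exists2 C : R, 0 <= C & forall j, j != i -> c i j = C.
  case: (pickP (fun j => j != i)) => [j0 j0i|none].
    exists (c i j0); first exact: ler0n.
    move=> j ji; rewrite /c -(card_draws_pair_perm (tperm j0 j) N i j0).
    by rewrite tpermL tpermD // eq_sym.
  by exists 0 => // j ji; have := none j; rewrite ji.
rewrite (bigD1 i) //=.
have -> : \sum_(j | j != i) c i j * (y i * y j) =
    C * y i * \sum_(j | j != i) y j.
  by rewrite mulr_sumr; apply: eq_bigr => j ji; rewrite cC //; ring.
have -> : \sum_(j | j != i) y j = - y i.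
  move: y_centered; rewrite (bigD1 i) //= addrC => /eqP.
  by rewrite addr_eq0 => /eqP.
by have := mulr_ge0 C_ge0 (sqr_ge0 (y i)); rewrite -expr2; lra.
Qed.

End ScalarSampling.

Section VectorSampling.
Context (R : realType) (d n : nat) (Y : 'I_n -> 'rV[R]_d).
Hypothesis n_gt0 : (0 < n)%N.

Let sum_enorm_sq : \sum_i enorm (Y i) ^+ 2 = \sum_j \sum_i Y i 0 j ^+ 2.
Proof. by rewrite exchange_big; apply: eq_bigr => i _; exact: enorm_sq. Qed.

Lemma enorm_sq_centered_le :
  \sum_i enorm (Y i - n%:R^-1 *: \sum_j Y j) ^+ 2 <= \sum_i enorm (Y i) ^+ 2.
Proof.
set c := n%:R^-1 *: _.
have n0 : n%:R != 0 :> R by rewrite pnatr_eq0 -lt0n.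
have sumY : \sum_j Y j = n%:R *: c by rewrite scalerA divff // scale1r.
under eq_bigr do rewrite enorm_sqB.
rewrite big_split sumrB /= -mulr_sumr.
have -> : \sum_i dot (Y i) c = n%:R * enorm c ^+ 2.
  rewrite exchange_big enorm_sq mulr_sumr; apply: eq_bigr => j _ /=.
  by rewrite -mulr_suml -summxE sumY mxE; ring.
rewrite sumr_const card_ord -(mulr_natl (enorm c ^+ 2) n).
by have := mulr_ge0 (ler0n R n) (sqr_ge0 (enorm c)); lra.
Qed.

Lemma sum_centered : \sum_i (Y i - n%:R^-1 *: \sum_j Y j) = 0.
Proof.
have n0 : n%:R != 0 :> R by rewrite pnatr_eq0 -lt0n.
rewrite sumrB sumr_const card_ord -scaler_nat scalerA divff //.
by rewrite scale1r subrr.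
Qed.

Hypothesis Y_centered : \sum_i Y i = 0.

Let coord_centered j : \sum_i Y i 0 j = 0.
Proof. by rewrite -summxE Y_centered mxE. Qed.

(** With replacement: the entries are independent and centred, so the variances
    of the [B] terms and the square of the offset [c] add up. *)
Lemma minibatch_second_moment (B : nat) (c : 'rV[R]_d) : (0 < B)%N ->
  \sum_(b : B.-tuple 'I_n)
    (n ^ B)%N%:R^-1 * enorm (c + B%:R^-1 *: \sum_(i <- b) Y i) ^+ 2 =
  enorm c ^+ 2 + (B%:R * n%:R)^-1 * \sum_i enorm (Y i) ^+ 2.
Proof.
move=> B_gt0; have n0 : n%:R != 0 :> R by rewrite pnatr_eq0 -lt0n.
have B0 : B%:R != 0 :> R by rewrite pnatr_eq0 -lt0n.
rewrite -mulr_sumr natrX.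
under eq_bigr do rewrite enorm_sq.
rewrite exchange_big mulr_sumr enorm_sq /=.
rewrite sum_enorm_sq mulr_sumr -big_split /=.
apply: eq_bigr => j _.
pose z i := B%:R^-1 * Y i 0 j.
have z_centered : \sum_i z i = 0 by rewrite -mulr_sumr coord_centered mulr0.
transitivity (n%:R ^- B * \sum_(b : B.-tuple 'I_n) (c 0 j + \sum_(i <- b) z i) ^+ 2).
  congr (_ * _); apply: eq_bigr => b _.
  by rewrite !mxE summxE mulr_sumr.
rewrite tuple_sum_second_moment // mulKf ?expf_neq0 //.
have -> : \sum_i z i ^+ 2 = B%:R ^- 2 * \sum_i Y i 0 j ^+ 2.
  by rewrite mulr_sumr; apply: eq_bigr => i _; rewrite /z exprMn exprVn.
move: (\sum_i _) (c 0 j) (n%:R : R) (B%:R : R) n0 B0 => q c' n' B' n'0 B'0.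
by field; apply/andP.
Qed.

(** Without replacement: the variance is at most that of sampling with
    replacement, since distinct entries are negatively correlated. *)
Lemma subset_second_moment (N : nat) : (0 < N <= n)%N ->
  \sum_(A : {set 'I_n}) (if #|A| == N then 'C(n, N)%:R^-1 else 0) *
    enorm (N%:R^-1 *: \sum_(i in A) Y i) ^+ 2 <=
  (N%:R * n%:R)^-1 * \sum_i enorm (Y i) ^+ 2.
Proof.
move=> /andP[N_gt0 Nn]; have n0 : n%:R != 0 :> R by rewrite pnatr_eq0 -lt0n.
have N0 : N%:R != 0 :> R by rewrite pnatr_eq0 -lt0n.
have C0 : 'C(n, N)%:R != 0 :> R by rewrite pnatr_eq0 -lt0n bin_gt0.
have -> : \sum_(A : {set 'I_n}) (if #|A| == N then 'C(n, N)%:R^-1 else 0) *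
      enorm (N%:R^-1 *: \sum_(i in A) Y i) ^+ 2 =
    \sum_j ('C(n, N)%:R^-1 * N%:R ^- 2 *
      \sum_(A : {set 'I_n} | #|A| == N) (\sum_(i in A) Y i 0 j) ^+ 2).
  rewrite -mulr_sumr exchange_big mulr_sumr [RHS]big_mkcond /=.
  apply: eq_bigr => A _; case: ifP => _; last by rewrite mul0r.
  rewrite enorm_sqZ enorm_sq exprVn mulrA; congr (_ * _).
  by apply: eq_bigr => j _; rewrite summxE.
rewrite sum_enorm_sq mulr_sumr; apply: ler_sum => j _.
have := subset_sum_second_moment n_gt0 (coord_centered j) N.
have k_ge0 : 0 <= 'C(n, N)%:R^-1 * N%:R ^- 2 :> R.
  by rewrite mulr_ge0 ?invr_ge0 ?exprn_ge0 ?ler0n.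
move=> /(ler_wpM2l k_ge0) /le_trans; apply; rewrite le_eqVlt; apply/orP; left.
move: (\sum_i _) ('C(n, N)%:R : R) (n%:R : R) (N%:R : R) n0 N0 C0.
move=> q C n' N' n'0 N'0 C0.
by apply/eqP; field; apply/and3P.
Qed.

End VectorSampling.

(** * Error of the estimators after one draw *)

Section OneStep.
Context (R : realType) (d n : nat) (f : 'I_n -> 'rV[R]_d -> R) (L sigma : R).
Hypothesis n_gt0 : (0 < n)%N.
Hypothesis df : forall i x, differentiable (f i) x.
Hypothesis lf : forall i x y,
  enorm (grad (f i) x - grad (f i) y) <= L * enorm (x - y).
Hypothesis vf : forall x, n%:R^-1 *
  \sum_i enorm (grad (f i) x - grad (favg f) x) ^+ 2 <= sigma ^+ 2.

Let n0 : n%:R != 0 :> R. Proof. by rewrite pnatr_eq0 -lt0n. Qed.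

(** Put [Z i = grad (f i) x' - grad (f i) x].  The error [v - grad f x] of the
    previous estimator changes by the average over the batch of the centred
    [Z i]; the variance of [Z i] is at most its second moment, which the Lipschitz
    bound compares with [|x' - x|^2 = eta^2 |v|^2]. *)
Lemma minibatch_error_le (B : nat) (eta : R) (x x' v : 'rV[R]_d) : (0 < B)%N ->
  x' = x - eta *: v ->
  \sum_(b : B.-tuple 'I_n) (n ^ B)%N%:R^-1 *
    enorm (batch_grad f b x' - batch_grad f b x + v - grad (favg f) x') ^+ 2
  <= enorm (v - grad (favg f) x) ^+ 2
     + L ^+ 2 * eta ^+ 2 / B%:R * enorm v ^+ 2.
Proof.
move=> B_gt0 x'E; have B0 : B%:R != 0 :> R by rewrite pnatr_eq0 -lt0n.
pose Z i := grad (f i) x' - grad (f i) x.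
pose Y i := Z i - n%:R^-1 *: \sum_j Z j.
have Y_centered : \sum_i Y i = 0 by exact: sum_centered.
have meanZ : n%:R^-1 *: \sum_j Z j = grad (favg f) x' - grad (favg f) x.
  by rewrite !(grad_favg df) -scalerBr sumrB.
have E (b : B.-tuple 'I_n) :
    batch_grad f b x' - batch_grad f b x + v - grad (favg f) x' =
    (v - grad (favg f) x) + B%:R^-1 *: \sum_(i <- b) Y i.
  rewrite sumrB big_const_seq count_predT size_tuple iter_addr_0 meanZ.
  rewrite scalerBr -(scaler_nat B (_ - _)) scalerA mulVf // scale1r sumrB.
  rewrite /batch_grad size_tuple scalerBr.
  move: (_ *: _) (_ *: _) (grad _ _) (grad _ _) => u w g g'.
  by apply/rowP => j; rewrite !mxE; ring.
under eq_bigr do rewrite E.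
rewrite minibatch_second_moment // lerD2l.
have Zle : \sum_i enorm (Z i) ^+ 2 <= n%:R * (L ^+ 2 * eta ^+ 2 * enorm v ^+ 2).
  rewrite mulr_natl -[X in _ *+ X](card_ord n) -sumr_const.
  apply: ler_sum => i _.
  have := ler_pM (enorm_ge0 _) (enorm_ge0 _) (lf i x' x) (lf i x' x).
  rewrite -!expr2.
  rewrite exprMn (_ : x' - x = - eta *: v); last by rewrite x'E addrC addKr scaleNr.
  by rewrite enorm_sqZ sqrrN mulrA.
apply: le_trans (ler_wpM2l _ (le_trans (enorm_sq_centered_le _ n_gt0) Zle)) _.
  by rewrite invr_ge0 mulr_ge0.
rewrite le_eqVlt; apply/orP; left; apply/eqP.
move: (enorm v) (n%:R : R) (B%:R : R) n0 B0 => e n' B' n'0 B'0.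
by field; apply/andP.
Qed.

(** When [N = n] the batch is the whole sample and its gradient is exact, which is
    why the bound vanishes there: [sigma^2 / n] may exceed both variance targets of
    the algorithm. *)
Lemma large_batch_error_le (N : nat) (y : 'rV[R]_d) : (0 < N <= n)%N ->
  \sum_(A : {set 'I_n}) (if #|A| == N then 'C(n, N)%:R^-1 else 0) *
    enorm (batch_grad f (enum A) y - grad (favg f) y) ^+ 2
  <= if N == n then 0 else sigma ^+ 2 / N%:R.
Proof.
move=> /andP[N_gt0 Nn].
have N0 : N%:R != 0 :> R by rewrite pnatr_eq0 -lt0n.
pose Y i := grad (f i) y - n%:R^-1 *: \sum_j grad (f j) y.
have Y_centered : \sum_i Y i = 0 by exact: sum_centered.
have E (A : {set 'I_n}) : #|A| = N ->
    batch_grad f (enum A) y - grad (favg f) y = N%:R^-1 *: \sum_(i in A) Y i.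
  move=> AN; rewrite sumrB sumr_const AN -(grad_favg df) scalerBr -(scaler_nat N (grad _ _)).
  by rewrite scalerA mulVf // scale1r /batch_grad -cardE AN big_enum.
rewrite (eq_bigr (fun A : {set 'I_n} => (if #|A| == N then 'C(n, N)%:R^-1 else 0) *
    enorm (N%:R^-1 *: \sum_(i in A) Y i) ^+ 2)); last first.
  by move=> A _; case: eqP => [/E ->//|_]; rewrite !mul0r.
case: ifP => [/eqP Nn'|_].
  rewrite big1 // => A _; case: ifP => [/eqP AN|_]; last by rewrite mul0r.
  have -> : A = [set: 'I_n]%SET.
    by apply/eqP; rewrite eqEcard finset.subsetT finset.cardsT card_ord AN Nn' /=.
  rewrite (eq_bigl xpredT) => [|i]; last by rewrite inE.
  by rewrite Y_centered enorm_sqZ enorm_sq big1 ?mulr0 // => j _; rewrite mxE expr0n.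
apply: le_trans (subset_second_moment n_gt0 Y_centered _) _; first exact/andP.
have -> : \sum_i enorm (Y i) ^+ 2 =
    \sum_i enorm (grad (f i) y - grad (favg f) y) ^+ 2.
  by apply: eq_bigr => i _; rewrite /Y -(grad_favg df).
rewrite invfM -mulrA [leRHS]mulrC ler_wpM2l ?invr_ge0 //.
Qed.

(** A batch smaller than the whole sample has size at least [cbeta sigma^2 / beta]
    or [ceps sigma^2 / eps], hence variance at most [beta / alpha] or
    [eps / alpha]. *)
Lemma large_size_variance_le (cbeta ceps eps alpha beta : R) :
  0 < sigma -> 0 < eps -> 0 < alpha -> alpha <= cbeta -> alpha <= ceps ->
  0 <= beta ->
  let N := large_size n sigma eps cbeta ceps beta in
  (0 < N <= n)%N /\
  (if N == n then 0 else sigma ^+ 2 / N%:R) <= (beta + eps) / alpha.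
Proof.
move=> sigma_gt0 eps_gt0 alpha_gt0 a_cb a_ce beta_ge0 N.
have cb_gt0 := lt_le_trans alpha_gt0 a_cb.
have ce_gt0 := lt_le_trans alpha_gt0 a_ce.
have s2 : 0 < sigma ^+ 2 by rewrite exprn_gt0.
set cap := Num.min (ceps * sigma ^+ 2 / eps) n%:R.
pose c := if beta == 0 then cap else Num.min (cbeta * sigma ^+ 2 / beta) cap.
have cap_gt0 : 0 < cap.
  by rewrite lt_min ltr0n n_gt0 divr_gt0 // mulr_gt0.
have c_gt0 : 0 < c.
  rewrite /c; case: ifP => // /negbT beta0.
  by rewrite lt_min cap_gt0 divr_gt0 ?mulr_gt0 // lt_def beta0.
have c_cap : c <= cap by rewrite /c; case: ifP => // _; rewrite ge_min lexx orbT.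
have c_n : c <= n%:R by apply: le_trans c_cap _; rewrite ge_min lexx orbT.
have ceil_gt0 : 0 < Num.ceil c by rewrite ceil_gt0.
have NE : (N%:R : R) = (Num.ceil c)%:~R.
  by rewrite /N /large_size -/cap -/c natr_absz gtr0_norm.
have N_gt0 : (0 < N)%N by rewrite -(ltr0n R) NE ltr0z.
have cN : c <= N%:R by rewrite NE ceil_ge.
have Nn : (N <= n)%N.
  rewrite -(ler_nat R) NE -[n%:R]/(n%:~R) ler_int ceil_le_int //.
split; first by rewrite N_gt0.
case: eqP => [_|/eqP N_neq_n].
  by rewrite divr_ge0 ?addr_ge0 // ltW.
have N_gt0R : 0 < N%:R :> R by rewrite ltr0n.
rewrite ler_pdivrMr // mulrAC ler_pdivlMr //.
have NltnR : N%:R < n%:R :> R by rewrite ltr_nat ltn_neqAle N_neq_n.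
have c_cases : (0 < beta /\ c = cbeta * sigma ^+ 2 / beta) \/
    c = ceps * sigma ^+ 2 / eps \/ c = n%:R.
  have cap_cases : cap = ceps * sigma ^+ 2 / eps \/ cap = n%:R.
    by rewrite /cap /Num.min; case: ifP; [left|right].
  rewrite /c; case: ifP => [_|/negbT beta0]; first by right.
  rewrite [Num.min _ cap]/Order.min; case: ifP => _; last by right.
  by left; split=> //; rewrite lt_def beta0.
have weaken (e k : R) : 0 < e -> alpha <= k -> k * sigma ^+ 2 / e <= N%:R ->
    alpha * sigma ^+ 2 <= e * N%:R.
  move=> e_gt0 ak; rewrite ler_pdivrMr // [e * _]mulrC; apply: le_trans.
  by rewrite ler_wpM2r // ltW.
rewrite mulrC mulrDl.
case: c_cases => [[beta_gt0 cE]|[cE|cE]].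
- rewrite cE in cN; apply: le_trans (weaken _ _ beta_gt0 a_cb cN) _.
  by rewrite lerDl mulr_ge0 // ltW.
- rewrite cE in cN; apply: le_trans (weaken _ _ eps_gt0 a_ce cN) _.
  by rewrite lerDr mulr_ge0 // ltW.
- by rewrite cE leNgt NltnR in cN.
Qed.

End OneStep.

(** * Trajectories of the algorithm *)

Section Trajectory.
Context (R : realType) (d n B : nat) (f : 'I_n -> 'rV[R]_d -> R).
Context (x0 : 'rV[R]_d) (m : nat) (eta beta1 : R).
Implicit Types (w a : draws n B) (s t : nat).

(** The pair [(x_t^s, v_t^s)], for [s >= 1]. *)
Definition epoch w s t : 'rV[R]_d * 'rV[R]_d :=
  inner f eta (outer f x0 m eta beta1 w s.-1).1 (large w s) (mini w s) t.

Definition grad_sq w s t : R := enorm (grad (favg f) (epoch w s t).1) ^+ 2.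
Definition est_sq w s t : R := enorm (epoch w s t).2 ^+ 2.
Definition err_sq w s t : R :=
  enorm ((epoch w s t).2 - grad (favg f) (epoch w s t).1) ^+ 2.

Lemma innerS (y : 'rV[R]_d) (N : {set 'I_n}) (b : nat -> B.-tuple 'I_n) t :
  inner f eta y N b t.+1 =
  let xv := inner f eta y N b t in
  let x' := xv.1 - eta *: xv.2 in
  (x', batch_grad f (b t.+1) x' - batch_grad f (b t.+1) xv.1 + xv.2).
Proof. by rewrite /=; case: (inner _ _ _ _ _ t). Qed.

Lemma epochS w s t : let: (x, v) := epoch w s t in
  let x' := x - eta *: v in
  epoch w s t.+1 = (x', batch_grad f (mini w s t.+1) x'
                        - batch_grad f (mini w s t.+1) x + v).
Proof. by rewrite /epoch innerS; case: (inner _ _ _ _ _ t). Qed.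

Lemma eq_inner (y : 'rV[R]_d) (N : {set 'I_n}) (b b' : nat -> B.-tuple 'I_n) t :
  (forall t', (0 < t' <= t)%N -> b t' = b' t') ->
  inner f eta y N b t = inner f eta y N b' t.
Proof.
elim: t => // t IHt bb'; rewrite !innerS bb' ?ltnSn // IHt // => t' /andP[h1 h2].
by rewrite bb' // h1 leqW.
Qed.

Hypothesis m_gt0 : (0 < m)%N.

(** The mini-batch of index [m] is never drawn: it would only enter an
    estimator [v_m] that no step uses. *)
Lemma eq_outer w a s :
  (forall s', (0 < s' <= s)%N -> large w s' = large a s') ->
  (forall s' t', (0 < s' <= s)%N -> (0 < t' < m)%N ->
     mini w s' t' = mini a s' t') ->
  outer f x0 m eta beta1 w s = outer f x0 m eta beta1 a s.
Proof.
elim: s => // s IHs hl hm /=.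
rewrite IHs => [|s' /andP[h1 h2]|s' t' /andP[h1 h2] h3]; first last.
- by apply: hm; rewrite // h1 leqW.
- by apply: hl; rewrite // h1 leqW.
rewrite hl ?ltnSn //; set y := (outer _ _ _ _ _ a s).1.
have eqi t : (t < m)%N ->
    inner f eta y (large a s.+1) (mini w s.+1) t =
    inner f eta y (large a s.+1) (mini a s.+1) t.
  move=> tm; apply: eq_inner => t' /andP[t'0 t't].
  by apply: hm; rewrite ?ltnSn // t'0 (leq_ltn_trans t't).
congr pair.
  by rewrite -(prednK m_gt0) !innerS /= eqi // ltn_predL.
by congr (_ * _); apply: eq_bigr => t _; rewrite eqi.
Qed.

Lemma same_past_outer w a s t : (0 < s)%N -> same_past m s t w a ->
  outer f x0 m eta beta1 w s.-1 = outer f x0 m eta beta1 a s.-1.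
Proof.
case: s => // s _ [hl hm]; apply: eq_outer => [s' /andP[h1 h2]|s' t' /andP[h1 h2] h3].
  by apply: hl; rewrite // /precedes ltnS h2.
by apply: hm; rewrite // /precedes ltnS h2.
Qed.

Lemma same_past_epoch w a s t : (0 < s)%N -> (t < m)%N ->
  same_past m s t.+1 w a -> epoch w s t = epoch a s t.
Proof.
move=> s_gt0 tm past; have [hl hm] := past.
rewrite /epoch (same_past_outer s_gt0 past) hl ?/precedes ?eqxx ?orbT //.
apply: eq_inner => t' /andP[t'0 t't]; apply: hm => //.
  by rewrite t'0 (leq_ltn_trans t't).
by rewrite /precedes eqxx ltnS t't orbT.
Qed.

Lemma outer_grad_scale w s : (outer f x0 m eta beta1 w s.+1).2 =
  m%:R^-1 * \sum_(t < m) est_sq w s.+1 t.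
Proof. by []. Qed.

Lemma outer_scale_ge0 w s : 0 <= beta1 -> 0 <= (outer f x0 m eta beta1 w s).2.
Proof.
case: s => // s _; rewrite outer_grad_scale mulr_ge0 ?invr_ge0 //.
by apply: sumr_ge0 => t _; exact: sqr_ge0.
Qed.

(** Descent telescopes within an epoch, and across epochs because each starts where
    the previous one ended. *)
Lemma run_descent (L : R) w S :
  (0 < n)%N -> (forall i x, differentiable (f i) x) ->
  (forall i x y, enorm (grad (f i) x - grad (f i) y) <= L * enorm (x - y)) ->
  \sum_(s < S) \sum_(t < m) (eta / 2 * grad_sq w s.+1 t
    + eta / 2 * (1 - L * eta) * est_sq w s.+1 t - eta / 2 * err_sq w s.+1 t)
  <= favg f x0 - favg f (outer f x0 m eta beta1 w S).1.
Proof.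
move=> n_gt0 df lf.
have step s t : eta / 2 * grad_sq w s.+1 t
    + eta / 2 * (1 - L * eta) * est_sq w s.+1 t - eta / 2 * err_sq w s.+1 t <=
    favg f (epoch w s.+1 t).1 - favg f (epoch w s.+1 t.+1).1.
  have := epochS w s.+1 t; rewrite /grad_sq /est_sq /err_sq.
  case: (epoch w s.+1 t) => x v /= ->.
  by apply: inexact_gradient_step; exact: favg_descent.
elim: S => [|S IHS]; first by rewrite big_ord0 subrr.
rewrite big_ord_recr /=.
have tele : \sum_(t < m) (favg f (epoch w S.+1 t).1 - favg f (epoch w S.+1 t.+1).1)
    = favg f (epoch w S.+1 0).1 - favg f (epoch w S.+1 m).1.
  rewrite -(big_mkord xpredT (fun t => favg f (epoch w S.+1 t).1
    - favg f (epoch w S.+1 t.+1).1)) -[RHS]opprB.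
  by rewrite -(@telescope_sumr _ _ _ (fun t => favg f (epoch w S.+1 t).1)) // -sumrN;
    apply: eq_bigr => t _; rewrite opprB.
have := lerD IHS (@ler_sum _ _ (index_enum _) xpredT _ _ (fun (t : 'I_m) _ => step S t)).
by rewrite tele /epoch /= addrA subrK.
Qed.

End Trajectory.

(** * The tower rule and the final arithmetic *)

(** The tower rule on a finite probability space with weights [p].  The classes of
    [e] are the atoms of the past, [y] is the next draw, of law [k r] given the
    class of [r], and [G] looks at the past and at that draw. *)
Lemma sampling_tower (R : realType) (W Y : finType) (p : W -> R) (e : rel W)
    (y : W -> Y) (k : W -> Y -> R) (G : W -> Y -> R) :
  (forall r, e r r) -> (forall r a, e r a = e a r) ->
  (forall r a b, e r a -> e a b -> e r b) ->
  (forall a b, \sum_(r | e r a && (y r == b)) p r =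
               (\sum_(r | e r a) p r) * k a b) ->
  (forall r a b, e r a -> k r b = k a b /\ G r b = G a b) ->
  \sum_r p r * G r (y r) = \sum_r p r * \sum_b k r b * G r b.
Proof.
move=> e_refl e_sym e_trans law kG.
pose cls r := finset (fun r' => e r' r).
have clsE r a : (cls r == cls a) = e r a.
  apply/eqP/idP => [ra|ra].
    have : r \in cls a by rewrite -ra inE.
    by rewrite inE.
  apply/finset.setP => r'; rewrite !inE.
  by apply/idP/idP => h; [exact: e_trans h ra|apply: e_trans h _; rewrite e_sym].
rewrite (partition_big cls xpredT) // [RHS](partition_big cls xpredT) //=.
apply: eq_bigr => c _.
(* Both sums vanish over a [c] that is the class of no element. *)
case: (pickP (fun a => cls a == c)) => [a /eqP <-|none]; last first.
  by rewrite !big1 // => r rc; have := none r; rewrite rc.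
rewrite (eq_bigl (fun r => e r a)) // [RHS](eq_bigl (fun r => e r a)) //.
transitivity (\sum_b G a b * \sum_(r | e r a && (y r == b)) p r).
  rewrite (partition_big y xpredT) //=; apply: eq_bigr => b _.
  rewrite mulr_sumr; apply: eq_bigr => r /andP[ra /eqP ->].
  by rewrite (kG _ _ b ra).2 mulrC.
transitivity (\sum_b \sum_(r | e r a) p r * (k a b * G a b)).
  by apply: eq_bigr => b _; rewrite law -mulr_suml; ring.
rewrite exchange_big /=; apply: eq_bigr => r ra; rewrite mulr_sumr.
by apply: eq_bigr => b _; rewrite !(kG _ _ _ ra).1 !(kG _ _ _ ra).2.
Qed.

(** With [e = K eps / alpha], the hypotheses give [phi V + G / 2 <= D / eta + e] and
    [G <= psi V + 4 e], where [psi], the coefficient of [V], is [2 q + 2 / alpha + 2].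
    If [G <= e] the last term of the bound suffices; otherwise the [G / 2] of the
    first inequality absorbs half of [e]. *)
Lemma final_arithmetic (R : realType) (L eta alpha eps q K V E G D : R) :
  0 < eta -> 0 < alpha -> 0 < eps -> 0 <= q -> 0 < K -> 0 <= D ->
  E <= (2 * K * eps + V) / alpha + q * V ->
  eta / 2 * G + eta / 2 * (1 - L * eta) * V - eta / 2 * E <= D ->
  G <= 2 * E + 2 * V ->
  let psi := 2 * q + 2 / alpha + 2 in
  let phi := 2^-1 - (2 * alpha)^-1 - L * eta / 2 - q / 2 in
  0 < phi ->
  K^-1 * G <= psi * D / (phi * eta * K) + psi * eps / (2 * phi * alpha)
              + 4 * eps / alpha.
Proof.
move=> eta_gt0 alpha_gt0 eps_gt0 q_ge0 K_gt0 D_ge0 E_le descent G_le psi phi phi_gt0.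
pose a := alpha^-1; have a_gt0 : 0 < a by rewrite invr_gt0.
pose D' := D / eta; have D'_ge0 : 0 <= D' by rewrite divr_ge0 // ltW.
pose e := K * eps * a; have e_gt0 : 0 < e by rewrite !mulr_gt0.
have phiE : phi = 2^-1 - a / 2 - L * eta / 2 - q / 2 by rewrite /phi invfM /a; ring.
have psiE : psi = 2 * q + 2 * a + 2 by [].
have psi_ge0 : 0 <= psi by rewrite psiE; lra.
have E_le' : E <= 2 * e + a * V + q * V.
  by apply: le_trans E_le _; rewrite le_eqVlt; apply/orP; left; apply/eqP;
    rewrite /e /a; ring.
have descent' : 2^-1 * G + 2^-1 * (1 - L * eta) * V - 2^-1 * E <= D'.
  rewrite /D' ler_pdivlMr //; apply: le_trans descent.
  by rewrite le_eqVlt; apply/orP; left; apply/eqP; ring.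
have GV : G <= psi * V + 4 * e by rewrite psiE; lra.
have VG : phi * V + G / 2 <= D' + e.
  by rewrite phiE; move: descent' E_le'; lra.
have key : phi * G <= psi * D' + psi * e / 2 + 4 * phi * e.
  have pD : 0 <= psi * D' by exact: mulr_ge0.
  have pe : 0 <= psi * e by rewrite mulr_ge0 // ltW.
  have fe : 0 < phi * e by exact: mulr_gt0.
  have [Ge|eG] := leP G e.
    by have := ler_wpM2l (ltW phi_gt0) Ge; lra.
  have := ler_wpM2l (ltW phi_gt0) GV; have := ler_wpM2l psi_ge0 VG.
  have := ler_wpM2l psi_ge0 (ltW eG); lra.
have -> : psi * D / (phi * eta * K) + psi * eps / (2 * phi * alpha)
    + 4 * eps / alpha = K^-1 * ((psi * D' + psi * e / 2 + 4 * phi * e) / phi).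
  rewrite /D' /e /a; move: psi phi phi_gt0 {E_le descent psiE phiE psi_ge0 key VG GV}.
  move=> psi phi phi_gt0; field.
  by rewrite !gt_eqF.
by rewrite ler_pM2l ?invr_gt0 // ler_pdivlMr // mulrC.
Qed.

(** * The bound for a finite law of runs *)

Section FiniteLaw.
Context (R : realType) (d n B : nat) (f : 'I_n -> 'rV[R]_d -> R).
Context (L sigma : R) (x0 : 'rV[R]_d) (m S : nat).
Context (eta cbeta ceps beta1 eps alpha : R).
Hypothesis n_gt0 : (0 < n)%N.
Hypothesis m_gt0 : (0 < m)%N.
Hypothesis B_gt0 : (0 < B)%N.
Hypothesis S_gt0 : (0 < S)%N.
Hypothesis df : forall i x, differentiable (f i) x.
Hypothesis lf : forall i x y,
  enorm (grad (f i) x - grad (f i) y) <= L * enorm (x - y).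
Hypothesis f_lb : has_lbound (range (favg f)).
Hypothesis sigma_gt0 : 0 < sigma.
Hypothesis vf : forall x, n%:R^-1 *
  \sum_i enorm (grad (f i) x - grad (favg f) x) ^+ 2 <= sigma ^+ 2.
Hypothesis eps_gt0 : 0 < eps.
Hypothesis alpha_gt0 : 0 < alpha.
Hypothesis alpha_cbeta : alpha <= cbeta.
Hypothesis alpha_ceps : alpha <= ceps.
Hypothesis beta1_gt0 : 0 < beta1.
Hypothesis eta_gt0 : 0 < eta.
Hypothesis beta1_le : beta1 <= S%:R * eps.

(** [W] is a finite type of runs, [D r] the draws of the run [r] and [p r] its
    probability. *)
Context (W : finType) (D : W -> draws n B) (p : W -> R).
Hypothesis p_ge0 : forall r, 0 <= p r.
Hypothesis p_sum : \sum_r p r = 1.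

Let past s t (r a : W) : bool := `[< same_past m s t (D r) (D a) >].
Let size_of (w : draws n B) s := Nsize f x0 m eta sigma eps cbeta ceps beta1 w s.

Hypothesis large_law : forall s a (A : {set 'I_n}), (0 < s <= S)%N ->
  \sum_(r | past s 0 r a && (large (D r) s == A)) p r =
  (\sum_(r | past s 0 r a) p r) *
    (if #|A| == size_of (D a) s then 'C(n, size_of (D a) s)%:R^-1 else 0).
Hypothesis mini_law : forall s t a (b : B.-tuple 'I_n),
  (0 < s <= S)%N -> (0 < t < m)%N ->
  \sum_(r | past s t r a && (mini (D r) s t == b)) p r =
  (\sum_(r | past s t r a) p r) * (n ^ B)%N%:R^-1.

Let mean (g : draws n B -> R) : R := \sum_r p r * g (D r).
Let epoch' (w : draws n B) := epoch f x0 m eta beta1 w.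
Let gsq (w : draws n B) := grad_sq f x0 m eta beta1 w.
Let vsq (w : draws n B) := est_sq f x0 m eta beta1 w.
Let esq (w : draws n B) := err_sq f x0 m eta beta1 w.
Let scale (w : draws n B) s : R := (outer f x0 m eta beta1 w s).2.

Let ler_mean g h : (forall w, g w <= h w) -> mean g <= mean h.
Proof. by move=> gh; apply: ler_sum => r _; rewrite ler_wpM2l. Qed.

Let mean_cst c : mean (fun=> c) = c.
Proof. by rewrite /mean -mulr_suml p_sum mul1r. Qed.

Let meanD g h : mean (fun w => g w + h w) = mean g + mean h.
Proof. by rewrite /mean -big_split; apply: eq_bigr => r _; rewrite mulrDr. Qed.

Let meanZ c g : mean (fun w => c * g w) = c * mean g.
Proof. by rewrite /mean mulr_sumr; apply: eq_bigr => r _; rewrite mulrCA. Qed.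

Let mean_sum k (g : nat -> draws n B -> R) :
  mean (fun w => \sum_(i < k) g i w) = \sum_(i < k) mean (g i).
Proof.
by rewrite /mean exchange_big; apply: eq_bigr => r _; rewrite mulr_sumr.
Qed.

Let mean_ge0 g : (forall w, 0 <= g w) -> 0 <= mean g.
Proof. by move=> g0; apply: sumr_ge0 => r _; rewrite mulr_ge0. Qed.

Let past_equiv s t :
  [/\ forall r, past s t r r, forall r a, past s t r a = past s t a r
    & forall r a b, past s t r a -> past s t a b -> past s t r b].
Proof.
have sym w a : same_past m s t w a -> same_past m s t a w.
  by move=> [hl hm]; split=> *; [rewrite hl|rewrite hm].
split=> [r|r a|r a b].
- by apply/asboolP; split.
- by apply/asboolP/asboolP; exact: sym.
- move=> /asboolP[hl hm] /asboolP[hl' hm']; apply/asboolP; split=> *.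
    by rewrite hl ?hl'.
  by rewrite hm ?hm'.
Qed.

(** The pair [(x_t, v_t)] is a function of the draws that precede the mini-batch of
    index [t + 1], so the tower rule averages over that batch alone. *)
Lemma mean_err_mini s t : (0 < s <= S)%N -> (t.+1 < m)%N ->
  mean (fun w => esq w s t.+1) <=
  mean (fun w => esq w s t) + L ^+ 2 * eta ^+ 2 / B%:R * mean (fun w => vsq w s t).
Proof.
move=> sS tm; have s_gt0 : (0 < s)%N by case/andP: sS.
have [past_refl past_sym past_trans] := past_equiv s t.+1.
pose next (xv : 'rV[R]_d * 'rV[R]_d) (b : B.-tuple 'I_n) :=
  let x' := xv.1 - eta *: xv.2 in
  enorm (batch_grad f b x' - batch_grad f b xv.1 + xv.2 - grad (favg f) x') ^+ 2.
have nextE w : esq w s t.+1 = next (epoch' w s t) (mini w s t.+1).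
  have := epochS f x0 m eta beta1 w s t.
  by rewrite /esq /err_sq /next /epoch'; case: (epoch _ _ _ _ _ _ _ t) => x v /= ->.
rewrite [leLHS](_ : _ =
    \sum_r p r * \sum_b (n ^ B)%N%:R^-1 * next (epoch' (D r) s t) b); last first.
  transitivity (\sum_r p r * next (epoch' (D r) s t) (mini (D r) s t.+1)).
    by apply: eq_bigr => r _; rewrite nextE.
  apply: (sampling_tower (e := past s t.+1) (y := fun r => mini (D r) s t.+1)
    (k := fun _ _ => (n ^ B)%N%:R^-1)
    (G := fun r => next (epoch' (D r) s t))) => [| | |a b|r a b /asboolP ra].
  - exact: past_refl.
  - exact: past_sym.
  - exact: past_trans.
  - exact: mini_law.
  - split; first by [].
    by rewrite /epoch' (same_past_epoch _ _ _ _ m_gt0 s_gt0 (ltnW tm) ra).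
rewrite -meanZ -meanD; apply: ler_sum => r _; rewrite ler_wpM2l //.
exact: minibatch_error_le.
Qed.

(** The start of epoch [s], [beta_s] and hence the size of the large batch are
    functions of the draws of the earlier epochs. *)
Lemma mean_err_large s : (0 < s <= S)%N ->
  mean (fun w => esq w s 0) <= (mean (fun w => scale w s.-1) + eps) / alpha.
Proof.
move=> sS; have s_gt0 : (0 < s)%N by case/andP: sS.
have [past_refl past_sym past_trans] := past_equiv s 0.
pose err (y : 'rV[R]_d) (A : {set 'I_n}) :=
  enorm (batch_grad f (enum A) y - grad (favg f) y) ^+ 2.
pose start (w : draws n B) := (outer f x0 m eta beta1 w s.-1).1.
pose k (r : W) (A : {set 'I_n}) : R :=
  if #|A| == size_of (D r) s then 'C(n, size_of (D r) s)%:R^-1 else 0.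
rewrite [leLHS](_ : _ =
    \sum_r p r * \sum_A k r A * err (start (D r)) A); last first.
  apply: (sampling_tower (e := past s 0) (y := fun r => large (D r) s) (k := k)
    (G := fun r => err (start (D r)))) => [| | |a A|r a A /asboolP ra].
  - exact: past_refl.
  - exact: past_sym.
  - exact: past_trans.
  - exact: large_law.
  - by rewrite /k /start /size_of /Nsize (same_past_outer _ _ _ _ m_gt0 s_gt0 ra).
rewrite [leRHS](_ : _ = mean (fun w => (scale w s.-1 + eps) / alpha)); last first.
  transitivity (mean (fun w => alpha^-1 * (scale w s.-1 + eps))).
    by rewrite meanZ meanD mean_cst mulrC.
  by apply: eq_bigr => r _; rewrite [alpha^-1 * _]mulrC.
apply: ler_sum => r _; rewrite ler_wpM2l //.
have scale_ge0 : 0 <= scale (D r) s.-1 by apply: outer_scale_ge0; rewrite // ltW.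
have [N_bounds N_var] := large_size_variance_le n_gt0 sigma_gt0 eps_gt0 alpha_gt0
  alpha_cbeta alpha_ceps scale_ge0.
exact: le_trans (large_batch_error_le n_gt0 df vf _ N_bounds) N_var.
Qed.

Lemma mean_err s t : (0 < s <= S)%N -> (t < m)%N ->
  mean (fun w => esq w s t) <= (mean (fun w => scale w s.-1) + eps) / alpha
    + L ^+ 2 * eta ^+ 2 / B%:R * \sum_(i < m) mean (fun w => vsq w s i).
Proof.
move=> sS tm.
have c_ge0 : 0 <= L ^+ 2 * eta ^+ 2 / B%:R.
  by rewrite -exprMn divr_ge0 ?sqr_ge0 ?ler0n.
have vsq_ge0 i : 0 <= mean (fun w => vsq w s i).
  by apply: mean_ge0 => w; rewrite /vsq /est_sq sqr_ge0.
apply: (@le_trans _ _ ((mean (fun w => scale w s.-1) + eps) / alpha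
    + L ^+ 2 * eta ^+ 2 / B%:R * \sum_(i < t) mean (fun w => vsq w s i))).
  elim: t tm => [|t IHt] tm; first by rewrite big_ord0 mulr0 addr0 mean_err_large.
  apply: le_trans (mean_err_mini sS tm) _.
  by rewrite big_ord_recr mulrDr addrA lerD2r IHt // ltnW.
rewrite lerD2l ler_wpM2l // (big_ord_widen m (fun i => mean (fun w => vsq w s i))).
  rewrite [leRHS](bigID (fun i : 'I_m => (i < t)%N)) /= lerDl.
  exact: sumr_ge0.
exact: ltnW.
Qed.

Let total (h : draws n B -> nat -> nat -> R) : R :=
  \sum_(s < S) \sum_(t < m) mean (fun w => h w s.+1 t).

Lemma total_err : total esq <=
  (2 * (S * m)%N%:R * eps + total vsq) / alpha
  + L ^+ 2 * eta ^+ 2 / B%:R * m%:R * total vsq.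
Proof.
set c := L ^+ 2 * eta ^+ 2 / B%:R.
pose V s := \sum_(t < m) mean (fun w => vsq w s.+1 t).
have V_ge0 s : 0 <= V s.
  by apply: sumr_ge0 => t _; apply: mean_ge0 => w; rewrite /vsq /est_sq sqr_ge0.
have epoch_err (s : 'I_S) : \sum_(t < m) mean (fun w => esq w s.+1 t) <=
    m%:R * ((mean (fun w => scale w s) + eps) / alpha + c * V s).
  rewrite mulr_natl -[X in _ *+ X](card_ord m) -sumr_const.
  by apply: ler_sum => t _; apply: mean_err => //=; rewrite ltn_ord.
apply: le_trans (ler_sum _ (fun s _ => epoch_err s)) _.
(* [beta_{s+1}] averages the [|v_t|^2] of epoch [s], so the scales add up to
   [beta1 <= S eps] plus at most [1 / m] of the whole sum of the [|v_t|^2]. *)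
have scaleS s : mean (fun w => scale w s.+1) = m%:R^-1 * V s.
  by rewrite /V -(mean_sum m (fun t w => vsq w s.+1 t)) -meanZ.
have scales k : \sum_(s < k.+1) mean (fun w => scale w s) <=
    beta1 + m%:R^-1 * \sum_(s < k.+1) V s.
  rewrite big_ord_recl lerD //=.
    by rewrite le_eqVlt [X in X == _]mean_cst eqxx.
  under eq_bigr do rewrite /bump add1n scaleS.
  by rewrite -mulr_sumr ler_wpM2l ?invr_ge0 ?ler0n // big_ord_recr lerDl.
have {}scales := scales S.-1; rewrite (prednK S_gt0) in scales.
have m0 : m%:R != 0 :> R by rewrite pnatr_eq0 -lt0n.
have m_ge0 : 0 <= m%:R / alpha by rewrite divr_ge0 ?ler0n // ltW.
rewrite -mulr_sumr big_split /= -mulr_suml big_split /= -mulr_sumr.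
rewrite sumr_const card_ord -/(total vsq) -(mulr_natl eps S) natrM.
have := ler_wpM2l m_ge0 scales; have := ler_wpM2l m_ge0 beta1_le.
rewrite -[\sum_(s < S) V s]/(total vsq).
move: (\sum_(i < S) _) (total vsq) => b v h1 h2.
have -> : m%:R * ((b + S%:R * eps) / alpha + c * v) =
    m%:R / alpha * b + m%:R / alpha * (S%:R * eps) + c * m%:R * v by ring.
have -> : (2 * (S%:R * m%:R) * eps + v) / alpha + c * m%:R * v =
    m%:R / alpha * (beta1 + m%:R^-1 * v)
    + (m%:R / alpha * (S%:R * eps) - m%:R / alpha * beta1)
    + m%:R / alpha * (S%:R * eps) + c * m%:R * v.
  by field; rewrite m0 gt_eqF.
by lra.
Qed.

Let totalE (h : draws n B -> nat -> nat -> R) :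
  total h = mean (fun w => \sum_(s < S) \sum_(t < m) h w s.+1 t).
Proof.
rewrite (mean_sum S (fun s w => \sum_(t < m) h w s.+1 t)).
by apply: eq_bigr => s _; rewrite (mean_sum m (fun t w => h w s.+1 t)).
Qed.

Lemma total_descent :
  eta / 2 * total gsq + eta / 2 * (1 - L * eta) * total vsq - eta / 2 * total esq
  <= favg f x0 - inf (range (favg f)).
Proof.
rewrite -[- (_ * total esq)]mulNr !totalE -!meanZ -!meanD -[leRHS]mean_cst.
apply: ler_mean => w.
apply: (@le_trans _ _ (favg f x0 - favg f (outer f x0 m eta beta1 w S).1)).
  apply: le_trans (run_descent x0 m eta beta1 w S n_gt0 df lf).
  rewrite le_eqVlt; apply/orP; left; apply/eqP.
  rewrite !mulr_sumr -!big_split; apply: eq_bigr => s _ /=.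
  rewrite !mulr_sumr -!big_split; apply: eq_bigr => t _ /=.
  by rewrite mulNr.
by rewrite lerD2l lerN2; apply: ge_inf => //; exists (outer f x0 m eta beta1 w S).1.
Qed.

Lemma total_grad : total gsq <= 2 * total esq + 2 * total vsq.
Proof.
rewrite !totalE -!meanZ -!meanD; apply: ler_mean => w.
rewrite !mulr_sumr -big_split; apply: ler_sum => s _ /=.
rewrite !mulr_sumr -big_split; apply: ler_sum => t _ /=.
rewrite /gsq /esq /vsq /grad_sq /err_sq /est_sq addrC.
set v := (epoch _ _ _ _ _ _ _ _).2; set g := grad _ _.
by rewrite -{1}[g](subKr v) enorm_sqB_le.
Qed.

Lemma finite_law_bound :
  let fstar := inf (range (favg f)) in
  let K : R := (S * m)%N%:R in
  let psi := 2 * eta ^+ 2 * L ^+ 2 * m%:R / B%:R + 2 / alpha + 2 in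
  let phi := 2^-1 - (2 * alpha)^-1 - L * eta / 2
             - eta ^+ 2 * L ^+ 2 * m%:R / (2 * B%:R) in
  0 < phi ->
  K^-1 * total gsq <=
    psi * (favg f x0 - fstar) / (phi * eta * K)
    + psi * eps / (2 * phi * alpha) + 4 * eps / alpha.
Proof.
move=> fstar K psi phi phi_gt0.
have K_gt0 : 0 < K by rewrite ltr0n muln_gt0 S_gt0.
have fstar_le x : fstar <= favg f x by apply: ge_inf => //; exists x.
pose q := L ^+ 2 * eta ^+ 2 / B%:R * m%:R.
have q_ge0 : 0 <= q by rewrite /q -exprMn mulr_ge0 ?divr_ge0 ?sqr_ge0 ?ler0n.
have B0 : B%:R != 0 :> R by rewrite pnatr_eq0 -lt0n.
have psiE : psi = 2 * q + 2 / alpha + 2.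
  by rewrite /psi /q; congr (_ + _ + _); field.
have phiE : phi = 2^-1 - (2 * alpha)^-1 - L * eta / 2 - q / 2.
  by rewrite /phi /q; congr (_ - _); field.
rewrite phiE in phi_gt0 *; rewrite psiE.
apply: (final_arithmetic (L := L) (V := total vsq) (E := total esq)) => //.
- by rewrite subr_ge0.
- exact: total_err.
- exact: total_descent.
- exact: total_grad.
Qed.

End FiniteLaw.

(** * Encoding runs in a finite type *)

Section FiniteValued.
Context (R : realType) (dT : measure_display) (T : measurableType dT).
Context (P : probability T R) (W : finType) (h : T -> W).
Hypothesis mh : forall r, measurable [set w | h w = r].

Definition prob_of (r : W) : R := fine (P [set w | h w = r]).

Lemma prob_of_ge0 r : 0 <= prob_of r.
Proof. by rewrite fine_ge0. Qed.

Lemma expectation_finite (g : W -> R) : (forall r, 0 <= g r) ->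
  ('E_P[fun w => g (h w)] = (\sum_r prob_of r * g r)%R%:E)%E.
Proof.
move=> g_ge0; rewrite unlock.
transitivity (\int[P]_w \sum_r (g r * \1_[set w | h w = r] w)%:E)%E.
  apply: eq_integral => w _; rewrite sumEFin; congr EFin.
  rewrite (bigD1 (h w)) //= indicE mem_set // mulr1 big1 ?addr0 // => r rw.
  by rewrite indicE memNset ?mulr0 //= => hw; rewrite hw eqxx in rw.
rewrite ge0_integral_sum //; last first.
- by move=> r w _; rewrite lee_fin mulr_ge0.
- move=> r; apply/measurable_EFinP; exact: measurable_funM.
rewrite -sumEFin; apply: eq_bigr => r _.
rewrite (integralZl_indic _ (fun=> [set w | h w = r])) //; last first.
  by rewrite ltNge g_ge0.
by rewrite integral_indic // setIT muleC EFinM fineK // fin_num_measure.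
Qed.

Lemma measurable_finite (Q : pred W) : measurable [set w | Q (h w)].
Proof.
rewrite (_ : [set w | Q (h w)] = \bigcup_(r in [set r | Q r]) [set w | h w = r]).
  by apply: fin_bigcup_measurable => // r _.
apply/seteqP; split=> [w Qw|w [r Qr /= ->] //]; by exists (h w).
Qed.

Lemma probability_finite (Q : pred W) :
  P [set w | Q (h w)] = (\sum_(r | Q r) prob_of r)%:E.
Proof.
rewrite -(expectation_indic P (measurable_finite Q)).
rewrite (_ : \1_[set w | Q (h w)] = fun w => (Q (h w))%:R); last first.
  apply/funext => w; rewrite indicE; have [Qw|/negP Qw] := boolP (Q (h w)).
    by rewrite mem_set.
  by rewrite memNset.
rewrite (expectation_finite (g := fun r => (Q r)%:R)) //; congr EFin.
by rewrite [RHS]big_mkcond; apply: eq_bigr => r _; case: (Q r); rewrite ?mulr1 ?mulr0.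
Qed.

End FiniteValued.

Section Runs.
Context (n B m S : nat) (b0 : B.-tuple 'I_n).
Implicit Types (w a : draws n B) (s t : nat).

(** The draws [large w s], [1 <= s <= S], and [mini w s t], [1 <= t <= m - 1], that
    enter a run, shifted to start at 0. *)
Definition run : finType :=
  ({ffun 'I_S -> {set 'I_n}} * {ffun 'I_S * 'I_m.-1 -> B.-tuple 'I_n})%type.

Definition encode (w : draws n B) : run :=
  ([ffun s : 'I_S => large w s.+1],
   [ffun st : 'I_S * 'I_m.-1 => mini w st.1.+1 st.2.+1]).

(** The predecessors undo the shift of [encode]; the indices 0 and 1 decode alike,
    as no draw has index 0. *)
Definition decode (r : run) : draws n B := Draws
  (fun s => if insub s.-1 is Some s' then r.1 s' else finset.set0)
  (fun s t => match insub s.-1, insub t.-1 with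
              | Some s', Some t' => r.2 (s', t')
              | _, _ => b0
              end).

Lemma encodeK w : same_past m S.+1 0 (decode (encode w)) w.
Proof.
split=> [[//|s] _|[//|s] [//|t] _ /andP[_ tm]] /=;
  rewrite /precedes ltn0 andbF orbF ltnS => sS.
  by rewrite (insubT (fun i => i < S)%N sS) ffunE.
have tm' : (t < m.-1)%N by rewrite ltn_predRL.
by rewrite (insubT (fun i => i < S)%N sS) (insubT (fun i => i < m.-1)%N tm') ffunE.
Qed.

Lemma decodeK : cancel decode encode.
Proof.
move=> [lg mn]; congr pair; apply/ffunP.
  by move=> s; rewrite ffunE /= (insubT (fun i => i < S)%N (ltn_ord s));
    congr (lg _); apply: val_inj.
move=> [s t]; rewrite ffunE /= (insubT (fun i => i < S)%N (ltn_ord s)).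
rewrite (insubT (fun i => i < m.-1)%N (ltn_ord t)).
by congr (mn (_, _)); apply: val_inj.
Qed.

Lemma same_past_encode w a : same_past m S.+1 0 w a <-> encode w = encode a.
Proof.
split=> [[hl hm]|wa].
  congr pair; apply/ffunP.
    by move=> s; rewrite !ffunE hl // /precedes ltnS ltn_ord.
  move=> [s t]; rewrite !ffunE hm //; last by rewrite /precedes ltnS ltn_ord.
  by rewrite /= -ltn_predRL.
have [wl wm] := encodeK w; have [al am] := encodeK a.
by split=> *; rewrite -?wl // -?wm // wa ?al // ?am.
Qed.

Lemma same_past_le s t w a : (s <= S)%N ->
  same_past m S.+1 0 w a -> same_past m s t w a.
Proof.
move=> sS [hl hm].
have le_end s' t' u : precedes s' t' s t -> precedes s' u S.+1 0.
  rewrite /precedes => /orP[s's|/andP[/eqP -> _]].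
    by rewrite (ltn_trans s's).
  by rewrite ltnS sS.
by split=> [s' s'0 /le_end le|s' t' s'0 t'm /le_end le]; [rewrite hl|rewrite hm].
Qed.

(** Events about the past of [w] depend on its code only; this is how the laws of the
    draws are transported to the finite type of runs. *)
Lemma same_past_decode s t w a : (s <= S)%N ->
  same_past m s t w a <-> same_past m s t (decode (encode w)) a.
Proof.
move=> sS; have [hl hm] := same_past_le t sS (encodeK w).
split=> -[al am]; split=> *.
- by rewrite hl // al.
- by rewrite hm // am.
- by rewrite -hl // al.
- by rewrite -hm // am.
Qed.

End Runs.

(** * The expected squared gradient of the output *)

Lemma output_same_past (R : realType) (d n B : nat) (f : 'I_n -> 'rV[R]_d -> R)
    (x0 : 'rV[R]_d) (m S : nat) (eta beta1 : R) (w a : draws n B) (z : 'I_S * 'I_m) :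
  same_past m S.+1 0 w a -> output f x0 eta beta1 w z = output f x0 eta beta1 a z.
Proof.
move=> past; have m_gt0 : (0 < m)%N by case: m z {past} => [[_ []]|].
rewrite /output /iterate -!/(epoch f x0 m eta beta1 _ z.1.+1 z.2).
by rewrite (same_past_epoch _ _ _ _ m_gt0 _ _ (same_past_le z.2.+1 _ past)).
Qed.

Section Sampling.
Context (R : realType) (d n : nat) (f : 'I_n -> 'rV[R]_d -> R) (sigma : R).
Context (x0 : 'rV[R]_d) (m B S : nat) (eta cbeta ceps beta1 eps : R).
Context (dT : measure_display) (T : measurableType dT) (P : probability T R).
Context (xi : T -> draws n B) (zeta : T -> 'I_S * 'I_m) (b0 : B.-tuple 'I_n).
Hypothesis sampling :
  AbaSPIDER_sampling f x0 eta sigma eps cbeta ceps beta1 P xi zeta.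

Let enc (w : T) : run n B m S := encode m S (xi w).
Let p := prob_of P enc.
Let dec (r : run n B m S) : draws n B := decode b0 r.

Let measurable_enc r : measurable [set w | enc w = r].
Proof.
rewrite (_ : [set w | enc w = r] =
    (\bigcap_(s in [set: 'I_S]) [set w | large (xi w) s.+1 = r.1 s]) `&`
    (\bigcap_(st in [set: 'I_S * 'I_m.-1])
       [set w | mini (xi w) st.1.+1 st.2.+1 = r.2 st])).
  apply: measurableI; apply: fin_bigcap_measurable => //.
    by move=> s _; apply: (measurable_large sampling); rewrite ltn_ord.
  move=> st _; apply: (measurable_mini sampling); rewrite ?ltn_ord //.
  by rewrite /= -ltn_predRL.
apply/seteqP; split=> [w <-|w [hl hm]].
  by split=> i _ /=; rewrite ffunE.
rewrite /enc /encode; case: r hl hm => lg mn hl hm; congr pair; apply/ffunP => i.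
  by rewrite ffunE (hl i).
by rewrite ffunE (hm i).
Qed.

Let past_dec s t w a : (s <= S)%N ->
  same_past m s t (xi w) a <-> same_past m s t (dec (enc w)) a.
Proof. exact: same_past_decode. Qed.

Let past_enc s t a : (s <= S)%N ->
  P [set w | same_past m s t (xi w) (dec a)] =
  (\sum_(r | `[< same_past m s t (dec r) (dec a) >]) p r)%:E.
Proof.
move=> sS.
rewrite -(probability_finite P measurable_enc
  (fun r => `[< same_past m s t (dec r) (dec a) >])).
congr (P _); apply/seteqP; split=> w.
  by move=> /(past_dec _ _ _ sS) /asboolP.
by move=> /asboolP /(past_dec _ _ _ sS).
Qed.

Let past_draw_enc (Y : eqType) (y : draws n B -> Y) s t a c : (s <= S)%N ->
  (forall w, y (dec (enc w)) = y (xi w)) ->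
  P [set w | same_past m s t (xi w) (dec a) /\ y (xi w) = c] =
  (\sum_(r | `[< same_past m s t (dec r) (dec a) >] && (y (dec r) == c)) p r)%:E.
Proof.
move=> sS y_dec.
pose Q r := `[< same_past m s t (dec r) (dec a) >] && (y (dec r) == c).
rewrite -(probability_finite P measurable_enc Q).
congr (P _); apply/seteqP; split=> w /=; rewrite /Q y_dec.
  by move=> [/(past_dec _ _ _ sS)/asboolP -> /eqP].
by move=> /andP[/asboolP/(past_dec _ _ _ sS) ? /eqP].
Qed.

Lemma large_enc s a (A : {set 'I_n}) : (0 < s <= S)%N ->
  \sum_(r | `[< same_past m s 0 (dec r) (dec a) >] && (large (dec r) s == A)) p r =
  (\sum_(r | `[< same_past m s 0 (dec r) (dec a) >]) p r) *
  (if #|A| == Nsize f x0 m eta sigma eps cbeta ceps beta1 (dec a) s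
   then 'C(n, Nsize f x0 m eta sigma eps cbeta ceps beta1 (dec a) s)%:R^-1 else 0).
Proof.
move=> sS; have /andP[s_gt0 s_le] := sS; apply: EFin_inj.
have large_dec w : large (dec (enc w)) s = large (xi w) s.
  by have [hl _] := encodeK m S b0 (xi w); rewrite hl // /precedes ltnS s_le.
rewrite -(past_draw_enc (y := fun w => large w s)) //.
by rewrite (law_large sampling) // past_enc // EFinM.
Qed.

Lemma mini_enc s t a (b : B.-tuple 'I_n) : (0 < s <= S)%N -> (0 < t < m)%N ->
  \sum_(r | `[< same_past m s t (dec r) (dec a) >] && (mini (dec r) s t == b)) p r =
  (\sum_(r | `[< same_past m s t (dec r) (dec a) >]) p r) * (n ^ B)%N%:R^-1.
Proof.
move=> sS tm; have /andP[s_gt0 s_le] := sS; apply: EFin_inj.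
have mini_dec w : mini (dec (enc w)) s t = mini (xi w) s t.
  by have [_ hm] := encodeK m S b0 (xi w); rewrite hm // /precedes ltnS s_le.
rewrite -(past_draw_enc (y := fun w => mini w s t)) //.
by rewrite (law_mini sampling) // past_enc // EFinM.
Qed.

Lemma prob_enc_sum : \sum_r p r = 1.
Proof.
apply: EFin_inj; rewrite -(probability_finite P measurable_enc xpredT) /=.
by rewrite -[RHS](probability_setT P); congr (P _); apply/seteqP; split.
Qed.

Let past_end w r : same_past m S.+1 0 (xi w) (dec r) <-> enc w = r.
Proof.
apply: iff_trans (same_past_encode m S b0 (xi w) (dec r)) _.
by rewrite /dec decodeK.
Qed.

Let prob_enc_zeta r z :
  P [set w | (enc w, zeta w) = (r, z)] = ((S * m)%N%:R^-1 * p r)%:E.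
Proof.
rewrite mulrC EFinM.
have -> : (p r)%:E = P [set w | same_past m S.+1 0 (xi w) (dec r)].
  rewrite /p /prob_of fineK ?fin_num_measure //; congr (P _).
  by apply/seteqP; split=> w /past_end.
rewrite -(law_zeta sampling (dec r) z); congr (P _).
apply/seteqP; split=> w /=; first by case=> /past_end wr ->.
by case=> /past_end -> ->.
Qed.

(** The position of the output is uniform and independent of the run, so that the
    expectation splits into an average over positions of expectations over runs. *)
Lemma expectation_output :
  ('E_P[(fun w => enorm (grad (favg f)
           (output f x0 eta beta1 (xi w) (zeta w))) ^+ 2)%R] =
  ((S * m)%N%:R^-1 * \sum_(s < S) \sum_(t < m)
     \sum_r p r * grad_sq f x0 m eta beta1 (dec r) s.+1 t)%R%:E)%E.
Proof.
pose g (rz : run n B m S * ('I_S * 'I_m)) : R :=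
  enorm (grad (favg f) (output f x0 eta beta1 (dec rz.1) rz.2)) ^+ 2.
have -> : (fun w => enorm (grad (favg f)
      (output f x0 eta beta1 (xi w) (zeta w))) ^+ 2) =
    (fun w => g (enc w, zeta w)).
  apply/funext => w; rewrite /g /=.
  by rewrite (output_same_past _ _ _ _ _ (encodeK m S b0 (xi w))).
have measurable_pair rz : measurable [set w | (enc w, zeta w) = rz].
  case: rz => r z; rewrite (_ : [set w | _] = [set w | enc w = r] `&`
      [set w | zeta w = z]).
    by apply: measurableI; [|exact: (measurable_zeta sampling)].
  by apply/seteqP; split=> w /= [-> ->].
rewrite (expectation_finite P measurable_pair) => [|rz]; last exact: sqr_ge0.
congr EFin; rewrite [in RHS]pair_bigA mulr_sumr.
transitivity (\sum_r \sum_z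
    prob_of P (fun w => (enc w, zeta w)) (r, z) * g (r, z)).
  by rewrite pair_bigA; apply: eq_bigr => -[].
rewrite exchange_big.
apply: eq_bigr => -[s t] _; rewrite mulr_sumr; apply: eq_bigr => r _.
by rewrite /prob_of prob_enc_zeta [RHS]mulrA.
Qed.

End Sampling.

Theorem theorem2 (R : realType) (d n : nat) (f : 'I_n -> 'rV[R]_d -> R)
    (L sigma : R) (x0 : 'rV[R]_d) (m B S : nat)
    (eta cbeta ceps beta1 eps alpha : R)
    (dT : measure_display) (T : measurableType dT) (P : probability T R)
    (xi : T -> draws n B) (zeta : T -> 'I_S * 'I_m) :
  (0 < n)%N -> (0 < m)%N -> (0 < B)%N -> (0 < S)%N ->
  (forall i x, differentiable (f i) x) ->
  (forall i x y,
     enorm (grad (f i) x - grad (f i) y) <= L * enorm (x - y)) ->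
  has_lbound (range (favg f)) ->
  0 < sigma ->
  (forall x, n%:R^-1 *
     \sum_i enorm (grad (f i) x - grad (favg f) x) ^+ 2 <= sigma ^+ 2) ->
  0 < eps -> 0 < alpha -> alpha <= cbeta -> alpha <= ceps ->
  0 < beta1 -> 0 < eta -> beta1 <= S%:R * eps ->
  AbaSPIDER_sampling f x0 eta sigma eps cbeta ceps beta1 P xi zeta ->
  let fstar := inf (range (favg f)) in
  let K : R := (S * m)%N%:R in
  let psi := 2 * eta ^+ 2 * L ^+ 2 * m%:R / B%:R + 2 / alpha + 2 in
  let phi := 2^-1 - (2 * alpha)^-1 - L * eta / 2
             - eta ^+ 2 * L ^+ 2 * m%:R / (2 * B%:R) in
  0 < phi ->
  ('E_P[(fun w => enorm (grad (favg f)
                    (output f x0 eta beta1 (xi w) (zeta w))) ^+ 2)%R]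
   <= (psi * (favg f x0 - fstar) / (phi * eta * K)
       + psi * eps / (2 * phi * alpha) + 4 * eps / alpha)%R%:E)%E.
Proof.
move=> n_gt0 m_gt0 B_gt0 S_gt0 df lf f_lb sigma_gt0 vf eps_gt0 alpha_gt0.
move=> alpha_cbeta alpha_ceps beta1_gt0 eta_gt0 beta1_le sampling.
move=> fstar K psi phi phi_gt0.
pose b0 : B.-tuple 'I_n := nseq_tuple B (Ordinal n_gt0).
rewrite (expectation_output b0 sampling) lee_fin.
apply: (finite_law_bound (cbeta := cbeta) (ceps := ceps)
  n_gt0 m_gt0 B_gt0 S_gt0 df lf f_lb sigma_gt0 vf) => //.
- exact: prob_of_ge0.
- exact: (prob_enc_sum sampling).
- exact: (large_enc b0 sampling).
- exact: (mini_enc b0 sampling).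
Qed.
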